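(* Let $\mathscr{F}=(F_1,\dots,F_s)$ be an ordered collection of $k$-DNFs and let $p\in[0,1]$. Then for all $\ell,t\in\mathbb{N}$, \[ \Pr_{\rho\sim\mathcal{R}_p}\big[\mathrm{depth}(\mathrm{CCDT}_\ell(\mathscr{F}\restriction\rho))\ge t\big]\le s^{\lceil t/\ell\rceil}\big(p\,2^{O(k)}\big)^t. \]
   Context: $\mathcal{R}_p$ independently sets each variable to $*$ with probability $p$ and to $0$ or $1$ with probability $(1-p)/2$ each. For a restriction $\beta$ and a DNF $F$, $F\restriction\beta$ is obtained by substituting the fixed values (if some term becomes $1$ then $F\restriction\beta=1$; terms containing a literal set to $0$ are deleted; fixed literals are removed from the remaining terms); $\mathscr{F}\restriction\beta=(F_1\restriction\beta,\dots,F_s\restriction\beta)$. For a decision tree $T$, $T\restriction\beta$ replaces queries to variables fixed to $b$ by the $b$-subtree. Canonical decision tree $\mathrm{CDT}(F)$ of a $k$-DNF $F=C_1\lor C_2\lor\cdots$: let $T_i$ be the depth-$\le k$ tree querying the variables of $C_i$ until $C_i$ is determined. Start with the empty tree; in step $i$, for each $0$-leaf of the current tree, reached by branch $\pi$, if $T_i\restriction\pi$ still has a $1$-leaf attach $T_i\restriction\pi$ at that leaf (otherwise skip). $\mathrm{CDT}(F)$ is $k$-clipped (from each node at most $k$ decisions lead to a leaf). Canonical common $\ell$-partial decision tree $\mathrm{CCDT}_\ell(\mathscr{F})$ of an ordered collection of DNFs (identified with their canonical decision trees) $\mathscr{F}=(F_1,\dots,F_s)$, defined recursively: if $s=0$ it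 is the empty tree; if $\mathrm{depth}(\mathrm{CDT}(F_1))\le\ell$ it equals $\mathrm{CCDT}_\ell(F_2,\dots,F_s)$; otherwise let $\eta$ be the leftmost path of length $\ell+1$ from the root in $\mathrm{CDT}(F_1)$, let $T_\eta$ be the depth-$(\ell+1)$ tree exhaustively querying the variables of $\eta$, and at each leaf of $T_\eta$, corresponding to an assignment $\pi$, attach $\mathrm{CCDT}_\ell(\mathscr{F}\restriction\pi)$. The $O(\cdot)$ hides a universal constant. *)

(* Defs.v *)
From HB Require Import structures.
From mathcomp Require Import all_boot all_order all_algebra.

Set Implicit Arguments.
Unset Strict Implicit.
Unset Printing Implicit Defensive.

Import Order.TTheory GRing.Theory Num.Theory.

(* [None] stands for the symbol [*]. *)
Definition restriction (n : nat) := {ffun 'I_n -> option bool}.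

Definition free_restriction (n : nat) : restriction n := [ffun _ => None].

Definition assign n (beta : restriction n) (v : 'I_n) (b : bool) :
    restriction n :=
  [ffun w => if w == v then Some b else beta w].

(* [(v, true)] is the literal x_v and [(v, false)] its negation. *)
Definition literal (n : nat) := ('I_n * bool)%type.

Definition term (n : nat) := seq (literal n).

(* [[::]] is the constant 0 and [[:: [::]]] the constant 1. *)
Definition dnf (n : nat) := seq (term n).

(* As usual, the literals of a term are on pairwise distinct variables. *)
Definition is_kdnf n (k : nat) (F : dnf n) : bool :=
  all (fun C : term n => uniq (map fst C) && (size C <= k)) F.

Definition falsified n (beta : restriction n) (C : term n) : bool :=
  has (fun x : literal n => beta x.1 == Some (~~ x.2)) C.

Definition unfixed n (beta : restriction n) (C : term n) : term n :=
  [seq x <- C | beta x.1 == None].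

Definition restrict_dnf n (beta : restriction n) (F : dnf n) : dnf n :=
  let F' := [seq unfixed beta C | C <- F & ~~ falsified beta C] in
  if [::] \in F' then [:: [::]] else F'.

Definition restrict_dnfs n (beta : restriction n) (Fs : seq (dnf n)) :
    seq (dnf n) :=
  map (restrict_dnf beta) Fs.

(* In [Node v T0 T1] the left subtree [T0] is the one for x_v = 0. Ordinary
   decision trees have [L := bool]; partial decision trees carry no output,
   [L := unit]. *)
Inductive dtree (n : nat) (L : Type) : Type :=
| Leaf of L
| Node of 'I_n & dtree n L & dtree n L.

Arguments Leaf {n L}.
Arguments Node {n L}.

Fixpoint depth n L (T : dtree n L) : nat :=
  if T is Node _ T0 T1 then (maxn (depth T0) (depth T1)).+1 else 0.

Fixpoint restrict_tree n L (beta : restriction n) (T : dtree n L) :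
    dtree n L :=
  match T with
  | Leaf a => Leaf a
  | Node v T0 T1 =>
      match beta v with
      | Some b => if b then restrict_tree beta T1 else restrict_tree beta T0
      | None => Node v (restrict_tree beta T0) (restrict_tree beta T1)
      end
  end.

(* Replaces each leaf [Leaf a] of [T] by [g pi a], where [pi] is [pi0] extended
   by the assignment made along the branch to that leaf. *)
Fixpoint graft_from n L L' (pi0 : restriction n)
    (g : restriction n -> L -> dtree n L') (T : dtree n L) : dtree n L' :=
  match T with
  | Leaf a => g pi0 a
  | Node v T0 T1 =>
      Node v (graft_from (assign pi0 v false) g T0)
             (graft_from (assign pi0 v true) g T1)
  end.

Definition graft n L L' := @graft_from n L L' (free_restriction n).

Fixpoint has_one_leaf n (T : dtree n bool) : bool :=
  match T with
  | Leaf b => b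
  | Node _ T0 T1 => has_one_leaf T0 || has_one_leaf T1
  end.

Fixpoint term_tree n (C : term n) : dtree n bool :=
  match C with
  | [::] => Leaf true
  | (v, b) :: C' =>
      if b then Node v (Leaf false) (term_tree C')
      else Node v (term_tree C') (Leaf false)
  end.

Definition CDT_step n (T : dtree n bool) (C : term n) : dtree n bool :=
  graft (fun pi (b : bool) =>
    if b then Leaf true
    else let T' := restrict_tree pi (term_tree C) in
         if has_one_leaf T' then T' else Leaf false) T.

Definition CDT n (F : dnf n) : dtree n bool :=
  foldl (@CDT_step n) (Leaf false) F.

(* The leftmost (lexicographically first) path of length [d] from the root,
   with the decisions made along it; meaningful when [d <= depth T]. The path
   may end at an internal node. *)
Fixpoint leftmost_path n L (d : nat) (T : dtree n L) : seq (literal n) :=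
  match d, T with
  | d'.+1, Node v T0 T1 =>
      if d' <= depth T0 then (v, false) :: leftmost_path d' T0
      else (v, true) :: leftmost_path d' T1
  | _, _ => [::]
  end.

Definition exhaustive_tree n (vs : seq 'I_n) : dtree n unit :=
  foldr (fun v T => Node v T T) (Leaf tt) vs.

(* The recursion either drops the first DNF or fixes at least one variable that
   occurs in the collection; [fuel] bounds the number of recursive calls. *)
Fixpoint CCDT_fuel n (fuel l : nat) (Fs : seq (dnf n)) : dtree n unit :=
  match fuel, Fs with
  | fuel'.+1, F1 :: Fs' =>
      if depth (CDT F1) <= l then CCDT_fuel fuel' l Fs'
      else graft (fun pi _ => CCDT_fuel fuel' l (restrict_dnfs pi Fs))
             (exhaustive_tree (map fst (leftmost_path l.+1 (CDT F1))))
  | _, _ => Leaf tt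
  end.

(* The fuel is sufficient: [CCDT_nil], [CCDT_shallow] and [CCDT_deep] below are
   the defining equations of the canonical common partial decision tree. *)
Definition CCDT n (l : nat) (Fs : seq (dnf n)) : dtree n unit :=
  CCDT_fuel (n + size Fs) l Fs.

Section CCDTEquations.

Variable n : nat.
Implicit Types (F : dnf n) (Fs : seq (dnf n)) (v : 'I_n) (pi : restriction n).

Fixpoint tree_vars L (T : dtree n L) : seq 'I_n :=
  if T is Node v T0 T1 then v :: tree_vars T0 ++ tree_vars T1 else [::].

Definition dnf_vars F : seq 'I_n := map fst (flatten F).

Definition dnfs_vars Fs : seq 'I_n := flatten (map dnf_vars Fs).

Definition nb_vars Fs := #|[set v in dnfs_vars Fs]|.

Lemma graft_from_vars L L' (P : pred 'I_n) pi0
    (g : restriction n -> L -> dtree n L') (T : dtree n L) :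
    {in tree_vars T, forall v, P v} ->
    (forall pi a, {in tree_vars (g pi a), forall v, P v}) ->
  {in tree_vars (graft_from pi0 g T), forall v, P v}.
Proof.
elim: T pi0 => [a|v T0 IH0 T1 IH1] pi0 PT Pg w /=; first exact: Pg.
rewrite inE mem_cat => /orP[/eqP->|/orP[]].
- by apply: PT; rewrite mem_head.
- by apply: IH0 => // u u0; apply: PT; rewrite inE mem_cat u0 orbT.
- by apply: IH1 => // u u0; apply: PT; rewrite inE mem_cat u0 !orbT.
Qed.

Lemma restrict_tree_vars L pi (T : dtree n L) :
  {subset tree_vars (restrict_tree pi T) <= tree_vars T}.
Proof.
elim: T => [a|v T0 IH0 T1 IH1] //= w.
case: (pi v) => [[]|] /=; rewrite ?inE ?mem_cat.
- by move=> /IH1->; rewrite !orbT.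
- by move=> /IH0->; rewrite !orbT.
- by case/orP=> [->//|/orP[/IH0->|/IH1->]]; rewrite !orbT.
Qed.

Lemma term_tree_vars (C : term n) : tree_vars (term_tree C) =i map fst C.
Proof.
elim: C => [//|[v b] C IH] w /=.
by case: b => /=; rewrite !inE ?cats0 IH.
Qed.

Lemma CDT_vars F : {subset tree_vars (CDT F) <= dnf_vars F}.
Proof.
suff gen G (T : dtree n bool) : {subset tree_vars T <= dnf_vars G} ->
    {subset tree_vars (foldl (@CDT_step n) T F) <= dnf_vars (G ++ F)}.
  exact: (gen [::]).
elim: F G T => [|C F IH] G T HT v /=; first by rewrite cats0; apply: HT.
rewrite -cat_rcons; apply: IH => {v}.
have GC : {subset dnf_vars G <= dnf_vars (rcons G C)}.
  by move=> v; rewrite /dnf_vars flatten_rcons map_cat mem_cat => ->.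
apply: graft_from_vars => [v /HT /GC //|pi [] //= v].
case: ifP => //= _ /restrict_tree_vars; rewrite term_tree_vars.
by rewrite /dnf_vars flatten_rcons map_cat mem_cat => ->; rewrite orbT.
Qed.

Lemma restrict_dnf_vars pi F v :
  v \in dnf_vars (restrict_dnf pi F) -> (v \in dnf_vars F) && (pi v == None).
Proof.
rewrite /restrict_dnf; case: ifP => // _ /mapP[x].
case/flattenP=> _ /mapP[C + ->]; rewrite !mem_filter.
case/andP=> _ CF /andP[pix xC] ->; rewrite pix andbT.
by apply: map_f; apply/flattenP; exists C.
Qed.

Lemma restrict_dnfs_vars pi Fs v :
    v \in dnfs_vars (restrict_dnfs pi Fs) ->
  (v \in dnfs_vars Fs) && (pi v == None).
Proof.
case/flattenP=> _ /mapP[_ /mapP[F FFs ->] ->] /restrict_dnf_vars /andP[vF ->].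
by rewrite andbT; apply/flattenP; exists (dnf_vars F) => //; apply: map_f.
Qed.

Lemma size_restrict_dnfs pi Fs : size (restrict_dnfs pi Fs) = size Fs.
Proof. exact: size_map. Qed.

Lemma nb_vars_restrict pi Fs v :
    v \in dnfs_vars Fs -> pi v != None ->
  nb_vars (restrict_dnfs pi Fs) < nb_vars Fs.
Proof.
move=> vFs piv; apply: proper_card; apply/properP; split.
  by apply/subsetP => w; rewrite !inE => /restrict_dnfs_vars /andP[].
exists v; rewrite inE //; apply: contra piv.
by case/restrict_dnfs_vars/andP.
Qed.

Lemma eq_graft_from L L' (P : restriction n -> Prop) pi0
    (g1 g2 : restriction n -> L -> dtree n L') (T : dtree n L) :
    P pi0 -> (forall pi v b, P pi -> P (assign pi v b)) ->
    (forall pi a, P pi -> g1 pi a = g2 pi a) ->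
  graft_from pi0 g1 T = graft_from pi0 g2 T.
Proof.
move=> + Passign eqg; elim: T pi0 => [a|v T0 IH0 T1 IH1] pi0 Pp /=.
  exact: eqg.
by rewrite IH0 ?IH1 //; apply: Passign.
Qed.

Lemma assign_fixed pi v w b : pi v != None -> assign pi w b v != None.
Proof. by rewrite ffunE; case: ifP. Qed.

Lemma eq_graft_deep l F1 Fs (g1 g2 : restriction n -> unit -> dtree n unit) :
    l < depth (CDT F1) ->
    (forall pi, nb_vars (restrict_dnfs pi (F1 :: Fs)) < nb_vars (F1 :: Fs) ->
       g1 pi tt = g2 pi tt) ->
  let T := exhaustive_tree (map fst (leftmost_path l.+1 (CDT F1))) in
  graft g1 T = graft g2 T.
Proof.
have := @CDT_vars F1; case: (CDT F1) => [//|v T0 T1] vF _ eqg /=.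
have vFs : v \in dnfs_vars (F1 :: Fs).
  by rewrite mem_cat vF // mem_head.
have eqg' pi a : pi v != None -> g1 pi a = g2 pi a.
  by case: a => piv; apply: eqg; apply: nb_vars_restrict piv.
rewrite /graft; case: ifP => _ /=.
all: congr Node; apply: (@eq_graft_from _ _ (fun pi => pi v != None)) => //.
all: by [rewrite ffunE eqxx | move=> pi w b; apply: assign_fixed].
Qed.

Lemma CCDT_fuel_enough l m1 m2 Fs :
    nb_vars Fs + size Fs <= m1 -> nb_vars Fs + size Fs <= m2 ->
  CCDT_fuel m1 l Fs = CCDT_fuel m2 l Fs.
Proof.
elim: m1 m2 Fs => [|m1 IH] [|m2] [|F1 Fs] //=; rewrite ?addnS //.
rewrite !ltnS => le1 le2.
have leFs : nb_vars Fs <= nb_vars (F1 :: Fs).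
  by apply/subset_leq_card/subsetP => v; rewrite !inE mem_cat => ->; rewrite orbT.
case: leqP => [_|ltl].
  by apply: IH; [apply: leq_trans le1 | apply: leq_trans le2]; rewrite leq_add2r.
apply: (@eq_graft_deep _ _ Fs) => // pi lt; apply: IH.
all: rewrite [size _]/= size_restrict_dnfs addnS -addSn.
  by apply: leq_trans le1; rewrite leq_add2r.
by apply: leq_trans le2; rewrite leq_add2r.
Qed.

Lemma nb_vars_le Fs : nb_vars Fs <= n.
Proof. by rewrite -[leqRHS]card_ord max_card. Qed.

Lemma CCDT_nil l : CCDT l ([::] : seq (dnf n)) = Leaf tt.
Proof. by rewrite /CCDT; case: (n + _). Qed.

Lemma CCDT_shallow l F1 Fs :
  depth (CDT F1) <= l -> CCDT l (F1 :: Fs) = CCDT l Fs.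
Proof. by move=> lel; rewrite /CCDT /= addnS /= lel. Qed.

Lemma CCDT_deep l F1 Fs :
    l < depth (CDT F1) ->
  CCDT l (F1 :: Fs) =
    graft (fun pi _ => CCDT l (restrict_dnfs pi (F1 :: Fs)))
      (exhaustive_tree (map fst (leftmost_path l.+1 (CDT F1)))).
Proof.
move=> ltl; rewrite {1}/CCDT [size _]/= addnS [LHS]/= leqNgt ltl.
apply: (@eq_graft_deep _ _ Fs) => // pi lt; apply: CCDT_fuel_enough.
  rewrite [size _]/= ?size_restrict_dnfs addnS -addSn leq_add2r.
  exact: leq_trans lt (nb_vars_le _).
by rewrite leq_add2r nb_vars_le.
Qed.

End CCDTEquations.

Local Open Scope ring_scope.

Definition Rp_weight (R : realFieldType) (n : nat) (p : R)
    (rho : restriction n) : R :=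
  \prod_(i < n) (if rho i == None then p else (1 - p) / 2).

Definition Pr_Rp (R : realFieldType) (n : nat) (p : R)
    (E : pred (restriction n)) : R :=
  \sum_(rho : restriction n | E rho) Rp_weight p rho.

Definition ceil_div (t l : nat) : nat := ((t + l.-1) %/ l)%N.

(* Main.v *)
(** Instead of encoding bad restrictions, expose [rho] term by term while
    following the tree, as in Hastad's original switching lemma. The information
    that a skipped term is falsified is kept in a nonnegative weight [Delta]
    that can only grow when stars are replaced by values. If the next term is
    not falsified, its variables are all exposed: comparing the patterns of
    stars to the pattern where the term is satisfied, each star costs [p]
    instead of [(1 - p) / 2], and there are at most [2 ^ k] patterns. Since the
    canonical tree leaves a term as soon as it is falsified, some exposed stars
    may stay unqueried; they have been paid for in advance, so the bound of a
    state carries a factor [(4 p)^-1] for each of them, which is used up when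
    the star is finally queried. A query thus costs [4 p] times [4 ^ k], where
    the factor [4 ^ k] absorbs the [2 ^ k * 2 ^ k] choices made in a term. A
    block of [l + 1] queries multiplies the bound by [s] for the choice of the
    formula and by [2 ^ (l + 1)] for the reassignment of the queried variables;
    since the bound holds for every weight [Delta] and every exposed state,
    blocks are chained by induction. *)

Require Import Defs.
From HB Require Import structures.
From mathcomp Require Import all_boot all_order all_algebra.
From mathcomp Require Import ring lra zify.

Set Implicit Arguments.
Unset Strict Implicit.
Unset Printing Implicit Defensive.

Import Order.TTheory GRing.Theory Num.Theory.
Local Open Scope ring_scope.

(** * Changing one coordinate of a function *)

Section Updates.

Variables (n : nat) (T : Type).
Implicit Types (f : {ffun 'I_n -> T}) (v w : 'I_n) (x y : T).

Definition upd f v x : {ffun 'I_n -> T} :=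
  [ffun w => if w == v then x else f w].

Lemma upd_same f v x : upd f v x v = x.
Proof. by rewrite ffunE eqxx. Qed.

Lemma upd_upd f v x y : upd (upd f v x) v y = upd f v y.
Proof. by apply/ffunP => w; rewrite !ffunE; case: eqP. Qed.

Lemma upd_id f v : upd f v (f v) = f.
Proof. by apply/ffunP => w; rewrite !ffunE; case: eqP => // ->. Qed.

Lemma updC f v w x y :
  v != w -> upd (upd f v x) w y = upd (upd f w y) v x.
Proof.
move=> vw; apply/ffunP => u; rewrite !ffunE.
by case: (eqVneq u w) => // ->; rewrite eq_sym (negPf vw).
Qed.

(** Cross-multiplied so that [g (f v)] may vanish. Used both for the weight of a restriction and for
    the price of a state. *)
Lemma prod_upd (R : comPzRingType) (g : T -> R) f v x :
  g (f v) * (\prod_i g (upd f v x i)) = g x * (\prod_i g (f i)).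
Proof.
rewrite (bigD1 v) //= (bigD1 (P := xpredT) v) //= upd_same mulrCA.
congr (_ * (_ * _)); apply: eq_bigr => i /negPf iv.
by rewrite ffunE iv.
Qed.

End Updates.

Section Trees.

Variable n : nat.
Implicit Types (F : dnf n) (Fs : seq (dnf n)) (v : 'I_n).
Implicit Types (rho pi sigma : restriction n) (C D : term n).

(** * Canonical decision trees of restricted DNFs *)

(** [rho] takes precedence, since [pi] acts later on what [rho] left free. *)
Definition comb rho pi : restriction n :=
  [ffun v => if rho v is Some b then Some b else pi v].

Lemma comb_free rho : comb rho (free_restriction n) = rho.
Proof. by apply/ffunP => v; rewrite !ffunE; case: (rho v). Qed.

Lemma comb_assign rho pi v b :
  rho v = None -> comb rho (assign pi v b) = assign (comb rho pi) v b.
Proof.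
move=> rv; apply/ffunP => w; rewrite !ffunE.
by case: eqP => [->|//]; rewrite rv.
Qed.

Lemma unfixed_comb rho pi C :
  unfixed pi (unfixed rho C) = unfixed (comb rho pi) C.
Proof.
rewrite /unfixed -filter_predI; apply: eq_filter => x /=.
by rewrite ffunE; case: (rho x.1) => [b|]; rewrite ?andbF ?andbT.
Qed.

Lemma falsified_comb rho pi C :
  falsified (comb rho pi) C = falsified rho C || falsified pi (unfixed rho C).
Proof.
elim: C => [//|x C IH]; rewrite /falsified /unfixed /= in IH *.
rewrite IH ffunE; case rx: (rho x.1) => [b|] //=.
  by rewrite orbA.
by rewrite orbCA.
Qed.

Lemma restrict_dnf_comb rho pi F :
  restrict_dnf pi (restrict_dnf rho F) = restrict_dnf (comb rho pi) F.
Proof.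
rewrite {2}/restrict_dnf; case: ifP => [|_].
  case/mapP=> C; rewrite mem_filter => /andP[nfC CF] C0.
  rewrite /restrict_dnf /= ifT //.
  apply/mapP; exists C; last by rewrite -unfixed_comb -C0.
  by rewrite mem_filter falsified_comb (negPf nfC) -C0.
rewrite /restrict_dnf.
suff -> : [seq unfixed pi C | C <- [seq unfixed rho C | C <- F
    & ~~ falsified rho C] & ~~ falsified pi C]
  = [seq unfixed (comb rho pi) C | C <- F & ~~ falsified (comb rho pi) C].
  by [].
elim: F => [//|C F IH] /=; rewrite falsified_comb.
case: (falsified rho C) => //=; case: (falsified pi _) => //=.
by rewrite IH unfixed_comb.
Qed.

Lemma restrict_dnfs_comb rho pi Fs :
  restrict_dnfs pi (restrict_dnfs rho Fs) = restrict_dnfs (comb rho pi) Fs.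
Proof.
rewrite /restrict_dnfs -map_comp; apply: eq_map => F.
exact: restrict_dnf_comb.
Qed.

Lemma graft_from_comp L L' L'' pi0 (g : restriction n -> L' -> dtree n L'')
    (h : restriction n -> L -> dtree n L') (T : dtree n L) :
  graft_from pi0 g (graft_from pi0 h T) =
  graft_from pi0 (fun pi a => graft_from pi g (h pi a)) T.
Proof. by elim: T pi0 => //= v T0 IH0 T1 IH1 pi0; rewrite IH0 IH1. Qed.

Lemma graft_from_ext L L' pi0 (g h : restriction n -> L -> dtree n L')
    (T : dtree n L) :
  g =2 h -> graft_from pi0 g T = graft_from pi0 h T.
Proof.
by move=> gh; elim: T pi0 => //= v T0 IH0 T1 IH1 pi0; rewrite IH0 IH1.
Qed.

(** Passes from branches recorded relative to a restricted formula to global states that also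
    contain [rho]. *)
Lemma graft_from_comb L L' rho pi0 (g h : restriction n -> L -> dtree n L')
    (T : dtree n L) :
    {in tree_vars T, forall v, rho v = None} ->
    (forall pi a, g pi a = h (comb rho pi) a) ->
  graft_from pi0 g T = graft_from (comb rho pi0) h T.
Proof.
move=> Tfree gh; elim: T pi0 Tfree => [a|v T0 IH0 T1 IH1] pi0 Tfree //=.
have rv : rho v = None by apply: Tfree; rewrite /= mem_head.
rewrite -!comb_assign // IH0 ?IH1 // => w wT; apply: Tfree.
all: by rewrite /= inE mem_cat wT !orbT.
Qed.

Lemma restrict_term_tree pi C :
    ~~ falsified pi C ->
  restrict_tree pi (term_tree C) = term_tree (unfixed pi C).
Proof.
elim: C => [//|[v b] C IH]; rewrite /falsified /= negb_or => /andP[pv /IH {}IH].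
by case: b pv => /=; case: (pi v) => [[]|] //= _; rewrite IH.
Qed.

Lemma has_one_leaf_term_tree pi C :
  has_one_leaf (restrict_tree pi (term_tree C)) = ~~ falsified pi C.
Proof.
elim: C => [//|[v b] C IH]; rewrite /falsified /= negb_or -IH.
by case: b => /=; case: (pi v) => [[]|] //=; rewrite orbF.
Qed.

(* The canonical decision tree of [F] restricted to [sigma], in continuation
   form; a term satisfied by [sigma] gives a leaf here, whereas [restrict_dnf]
   collapses the whole DNF as soon as some term is satisfied. *)
Fixpoint walk_tree F sigma : dtree n bool :=
  if F is C :: F' then
    if falsified sigma C then walk_tree F' sigma
    else graft_from sigma
           (fun sigma' (b : bool) =>
              if b then Leaf true else walk_tree F' sigma')
           (term_tree (unfixed sigma C))
  else Leaf false.

(** The canonical tree grows at its leaves, while [walk_tree] recurses on the first term;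
    generalising over the tree [T] built so far reconciles the two directions. *)
Lemma foldl_CDT_step rho F (T : dtree n bool) :
  foldl (@CDT_step n) T [seq unfixed rho C | C <- F & ~~ falsified rho C] =
  graft (fun pi (b : bool) =>
    if b then Leaf true else walk_tree F (comb rho pi)) T.
Proof.
elim: F T => [|C F IH] T /=.
  rewrite /graft; elim: T (free_restriction n) => [[]|v T0 IH0 T1 IH1] pi //=.
  by rewrite -IH0 -IH1.
case rC: (falsified rho C) => /=.
  rewrite IH; apply: graft_from_ext => pi [] //.
  by rewrite falsified_comb rC.
rewrite IH /CDT_step /graft graft_from_comp; apply: graft_from_ext => pi [] //=.
rewrite has_one_leaf_term_tree falsified_comb rC /=.
case: ifPn => [nf|/negPn -> //]; rewrite (negPf nf) restrict_term_tree //.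
rewrite unfixed_comb; apply: graft_from_comb => // v.
rewrite term_tree_vars -unfixed_comb => /mapP[x].
by rewrite !mem_filter => /and3P[_ /eqP rx _] ->.
Qed.

(** Positive depth excludes the collapse to the constant 1, whose tree is a single leaf. *)
Lemma CDT_restrict rho F :
  (0 < depth (CDT (restrict_dnf rho F)))%N ->
  CDT (restrict_dnf rho F) = walk_tree F rho.
Proof.
rewrite /restrict_dnf; case: ifP => // _ _.
by rewrite /CDT foldl_CDT_step /graft /= comb_free.
Qed.

(** * Paths and blocks *)

(** Any path is allowed, not only the leftmost one, and [Q] sees only its variables: the answers
    will be overwritten by a reassignment. *)
Fixpoint has_path L d (T : dtree n L) (Q : pred (seq 'I_n)) : bool :=
  match d, T with
  | 0, _ => Q [::]
  | d'.+1, Leaf _ => false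
  | d'.+1, Node v T0 T1 =>
      has_path d' T0 (fun ys => Q (v :: ys))
      || has_path d' T1 (fun ys => Q (v :: ys))
  end.

Lemma has_path_leftmost L d (T : dtree n L) (Q : pred (seq 'I_n)) :
  (d <= depth T)%N -> Q (map fst (leftmost_path d T)) -> has_path d T Q.
Proof.
elim: d T Q => [|d IH] [a|v T0 T1] Q //=; rewrite ltnS leq_max.
case: ifP => [d0 _ QT|_ /= d1 QT]; apply/orP; [left|right]; exact: IH.
Qed.

Lemma eq_has_path L d (T : dtree n L) (Q Q' : pred (seq 'I_n)) :
  Q =1 Q' -> has_path d T Q = has_path d T Q'.
Proof.
elim: d T Q Q' => [|d IH] [a|v T0 T1] Q Q' QQ //=.
by congr orb; apply: IH => ys.
Qed.

Lemma size_leftmost_path L d (T : dtree n L) :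
  (d <= depth T)%N -> size (leftmost_path d T) = d.
Proof.
elim: d T => [|d IH] [a|v T0 T1] //=; rewrite ltnS leq_max.
by case: ifP => [d0 _|_ /= d1]; rewrite /= IH.
Qed.

Lemma leftmost_path_vars L d (T : dtree n L) :
  {subset map fst (leftmost_path d T) <= tree_vars T}.
Proof.
elim: d T => [|d IH] [a|v T0 T1] //= w.
case: ifP => _ /=; rewrite !inE mem_cat => /orP[->//|/IH ->]; by rewrite !orbT.
Qed.

Fixpoint reassigned (ys : seq 'I_n) (P : pred (restriction n)) sigma : bool :=
  if ys is v :: ys' then
    reassigned ys' P (assign sigma v false)
    || reassigned ys' P (assign sigma v true)
  else P sigma.

Lemma reassigned_comb rho ys (P P' : pred (restriction n)) pi :
    {in ys, forall v, rho v = None} -> (forall pi, P pi = P' (comb rho pi)) ->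
  reassigned ys P pi = reassigned ys P' (comb rho pi).
Proof.
move=> + PP; elim: ys pi => [|v ys IH] pi yfree //=.
have rv : rho v = None by apply: yfree; rewrite mem_head.
by rewrite -!comb_assign // !IH // => w wy; apply: yfree; rewrite inE wy orbT.
Qed.

Lemma reassigned_congr ys (P : pred (restriction n)) sigma sigma' :
  (forall v, v \notin ys -> sigma v = sigma' v) ->
  reassigned ys P sigma = reassigned ys P sigma'.
Proof.
elim: ys sigma sigma' => [|v ys IH] sigma sigma' ss /=.
  by congr P; apply/ffunP => v; apply: ss.
by congr orb; apply: IH => w wy; rewrite !ffunE; case: eqP => // /eqP wv;
  apply: ss; rewrite inE negb_or wv.
Qed.

Lemma depth_graft_exhaustive t (g : restriction n -> unit -> dtree n unit)
    ys pi :
    (t <= depth (graft_from pi g (exhaustive_tree ys)))%N ->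
  reassigned ys (fun pi => (t - size ys <= depth (g pi tt))%N) pi.
Proof.
elim: ys t pi => [|v ys IH] t pi /=; first by rewrite subn0.
case: t => [_|t]; last first.
  rewrite ltnS leq_max subSS => /orP[]/IH -> //; by rewrite orbT.
(* Here [t = 0], and truncated subtraction makes the threshold 0 for every reassignment. *)
have tr zs sigma :
    reassigned zs (fun pi => (0 - (size ys).+1 <= depth (g pi tt))%N) sigma.
  by elim: zs sigma => //= z zs IHz sigma; rewrite IHz.
by rewrite tr.
Qed.

Definition deep l t Fs rho : bool :=
  (t <= depth (CCDT l (restrict_dnfs rho Fs)))%N.

(** The remaining depth is asked of [F :: Fs], not of [Fs]: after a block the common tree starts
    again from the same collection, further restricted. *)
Definition block l t F Fs rho : bool :=
  has_path l.+1 (walk_tree F rho)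
    (fun ys => reassigned ys (deep l (t - l.+1) (F :: Fs)) rho).

Lemma deep_cons l t F Fs rho :
  deep l t (F :: Fs) rho -> deep l t Fs rho || block l t F Fs rho.
Proof.
rewrite /deep [restrict_dnfs _ _]/=.
have [le|lt] := leqP (depth (CDT (restrict_dnf rho F))) l.
  by rewrite CCDT_shallow // => ->.
rewrite CCDT_deep // => /depth_graft_exhaustive H; apply/orP; right.
set ys := map fst _ in H.
have yfree : {in ys, forall v, rho v = None}.
  move=> v /leftmost_path_vars /CDT_vars /restrict_dnf_vars.
  by case/andP=> _ /eqP.
have szy : size ys = l.+1 by rewrite size_map size_leftmost_path.
rewrite /block -CDT_restrict ?(leq_trans _ lt) //.
apply: has_path_leftmost => //; rewrite -/ys -[X in reassigned _ _ X]comb_free.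
rewrite -(reassigned_comb (rho := rho) (P := fun pi =>
  (t - size ys <= depth (CCDT l (restrict_dnfs pi
                           (restrict_dnfs rho (F :: Fs)))))%N)) //.
by move=> pi; rewrite /deep restrict_dnfs_comb szy.
Qed.

End Trees.

(** * Recording the queries of a block *)

Section Walks.

Variable n : nat.
Implicit Types (F : dnf n) (v : 'I_n) (sigma : restriction n) (D : term n).

(** [ys] holds the variables queried earlier in the block, to be reassigned together with those
    still to come. *)
Definition walk d (T : restriction n -> dtree n bool) (ys : seq 'I_n)
    (P : pred (restriction n)) sigma : bool :=
  has_path d (T sigma) (fun zs => reassigned (ys ++ zs) P sigma).

Definition term_walk_tree F D sigma : dtree n bool :=
  graft_from sigma
    (fun sigma' (b : bool) => if b then Leaf true else walk_tree F sigma')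
    (term_tree D).

Lemma walk0 T ys (P : pred (restriction n)) sigma :
  walk 0 T ys P sigma = reassigned ys P sigma.
Proof. by rewrite /walk; case: (T _) => /= *; rewrite cats0. Qed.

(** A falsifying answer leaves the term for [F], the other one stays in [D]. Recording the answer in
    the state is harmless because [v] is reassigned at the end of the block. *)
Lemma walk_term_cons F d v b D ys (P : pred (restriction n)) sigma :
  walk d.+1 (term_walk_tree F ((v, b) :: D)) ys P sigma =
  walk d (walk_tree F) (rcons ys v) P (assign sigma v (~~ b))
  || walk d (term_walk_tree F D) (rcons ys v) P (assign sigma v b).
Proof.
have E c (T : dtree n bool) :
    has_path d T (fun zs => reassigned (ys ++ v :: zs) P sigma)
    = has_path d T
        (fun zs => reassigned (rcons ys v ++ zs) P (assign sigma v c)).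
  apply: eq_has_path => zs; rewrite cat_rcons; apply: reassigned_congr => w.
  by rewrite mem_cat inE !negb_or ffunE => /and3P[_ /negPf ->].
rewrite /walk /term_walk_tree; case: b => /=; last rewrite orbC.
all: by congr orb; apply: E.
Qed.

End Walks.

(** * Expectation under a random restriction *)

Section Expectation.

Variables (R : realFieldType) (n : nat) (p : R).
Hypothesis p01 : 0 <= p <= 1.
Implicit Types (v : 'I_n) (rho : restriction n) (f g : restriction n -> R).

Definition expect f : R := \sum_rho Rp_weight p rho * f rho.

Lemma Rp_weight_ge0 rho : 0 <= Rp_weight p rho.
Proof.
by apply: prodr_ge0 => i _; case/andP: p01 => p0 p1; case: ifP => _; lra.
Qed.

Lemma expect_le f g : (forall rho, f rho <= g rho) -> expect f <= expect g.
Proof.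
move=> fg; apply: ler_sum => rho _; apply: ler_wpM2l => //.
exact: Rp_weight_ge0.
Qed.

Lemma expect_ge0 f : (forall rho, 0 <= f rho) -> 0 <= expect f.
Proof.
move=> f0; apply: sumr_ge0 => rho _; apply: mulr_ge0 => //.
exact: Rp_weight_ge0.
Qed.

Lemma eq_expect f g : f =1 g -> expect f = expect g.
Proof. by move=> fg; apply: eq_bigr => rho _; rewrite fg. Qed.

Lemma expectD f g : expect (fun rho => f rho + g rho) = expect f + expect g.
Proof.
by rewrite /expect -big_split; apply: eq_bigr => rho _; rewrite mulrDr.
Qed.

Lemma expect0 f : (forall rho, f rho = 0) -> expect f = 0.
Proof. by move=> f0; rewrite /expect big1 // => rho _; rewrite f0 mulr0. Qed.

Lemma big_option_bool (g : option bool -> R) b :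
  \sum_x g x = g None + g (Some b) + g (Some (~~ b)).
Proof.
rewrite (bigD1 None) //= (bigD1 (Some b)) //= (bigD1 (Some (~~ b))) /=.
  by rewrite big1 ?addr0 ?addrA // => -[c|] //; case: b; case: c.
by case: b.
Qed.

Lemma expect1 : expect (fun=> 1) = 1.
Proof.
rewrite /expect /Rp_weight; under eq_bigr do rewrite mulr1.
rewrite -(bigA_distr_bigA (fun _ (x : option bool) =>
  if x == None then p else (1 - p) / 2)) big1 // => i _.
by rewrite (big_option_bool _ true) /=; field.
Qed.

(* Resampling one coordinate: swapping the old and the new value preserves the
   joint distribution. *)
Lemma expect_upd f v b :
  expect f = p * expect (fun rho => f (upd rho v None))
           + (1 - p) / 2 * expect (fun rho => f (upd rho v (Some b)))
           + (1 - p) / 2 * expect (fun rho => f (upd rho v (Some (~~ b)))).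
Proof.
pose w (x : option bool) : R := if x == None then p else (1 - p) / 2.
have sw : \sum_x w x = 1 by rewrite (big_option_bool _ true) /w /=; field.
transitivity (\sum_x w x * expect (fun rho => f (upd rho v x))); last first.
  by rewrite (big_option_bool _ b).
transitivity (\sum_(z : restriction n * option bool)
    w z.2 * Rp_weight p z.1 * f z.1).
  rewrite -(pair_bigA _ (fun rho x => w x * Rp_weight p rho * f rho)) /=.
  by apply: eq_bigr => rho _; rewrite -!mulr_suml sw mul1r.
have swapK : involutive (fun z : restriction n * option bool =>
    (upd z.1 v z.2, z.1 v)).
  by case=> rho x; rewrite /= upd_same upd_upd upd_id.
rewrite (reindex_inj (inv_inj swapK)) /=.
rewrite -(pair_bigA _ (fun rho x =>
  w (rho v) * Rp_weight p (upd rho v x) * f (upd rho v x))) /= exchange_big /=.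
apply: eq_bigr => x _; rewrite /expect mulr_sumr; apply: eq_bigr => rho _.
by rewrite [w (rho v) * _](prod_upd w) mulrA.
Qed.

End Expectation.

(** * Domination of events under partial exposure *)

Section Domination.

Variables (R : realFieldType) (n : nat) (p : R).
Hypotheses (p_gt0 : 0 < p) (p_le : 4 * p <= 1).
Implicit Types (v : 'I_n) (rho sigma : restriction n) (C : term n).
Implicit Types (Delta : restriction n -> R) (A P : pred (restriction n)).

Local Ltac plra := move: p_gt0 p_le; lra.

Let p01 : 0 <= p <= 1.
Proof. by apply/andP; split; plra. Qed.

Local Notation expect := (expect p).

(* [Some None] marks a variable known to be a star, [None] one whose value has
   not been exposed. *)
Definition exposure := {ffun 'I_n -> option (option bool)}.
Implicit Type st : exposure.

(** Exposed coordinates override [rho], which keeps its full product distribution; this replaces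
    conditional probabilities. *)
Definition overlay st rho : restriction n :=
  [ffun v => if st v is Some x then x else rho v].

Lemma overlay_upd st rho v x :
  st v = None -> overlay st (upd rho v x) = overlay (upd st v (Some x)) rho.
Proof.
move=> sv; apply/ffunP => w; rewrite !ffunE.
by case: eqP => [->|//]; rewrite sv.
Qed.

Lemma assign_overlay st rho v b :
  assign (overlay st rho) v b = overlay (upd st v (Some (Some b))) rho.
Proof. by apply/ffunP => w; rewrite !ffunE; case: eqP. Qed.

Definition star_price (x : option (option bool)) : R :=
  if x == Some None then (4 * p)^-1 else 1.

Definition price st : R := \prod_v star_price (st v).

Lemma star_price_ge1 x : 1 <= star_price x.
Proof.
by rewrite /star_price; case: ifP => // _; rewrite invf_ge1 //; plra.
Qed.

Lemma price_ge1 st : 1 <= price st.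
Proof.
rewrite /price; elim/big_ind: _ => // [x y x1 y1|v _]; first by nra.
exact: star_price_ge1.
Qed.

Lemma price_upd st v x :
  star_price (st v) * price (upd st v x) = star_price x * price st.
Proof. exact: prod_upd. Qed.

Lemma price_assign_star st v b :
  st v = Some None -> price (upd st v (Some (Some b))) = 4 * p * price st.
Proof.
move=> sv; have := price_upd st v (Some (Some b)).
rewrite sv /star_price /= mul1r => <-; rewrite mulrA divff ?mul1r //.
by rewrite gt_eqF //; plra.
Qed.

Definition antitone Delta : Prop :=
  forall rho v b, Delta (upd rho v None) <= Delta (upd rho v (Some b)).

(** The event sees the overlay but [Delta] sees [rho] itself: a weight depending on exposed values
    has [st] built into it, as in [antitone_falsified]. *)
Definition dominated (kappa : R) st A : Prop :=
  forall Delta, (forall rho, 0 <= Delta rho) -> antitone Delta ->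
  expect (fun rho => Delta rho * (A (overlay st rho))%:R)
    <= kappa * price st * expect Delta.

Lemma dominated_mono kappa st st' A A' kappa' :
    dominated kappa' st' A' ->
    (forall rho, A (overlay st rho) -> A' (overlay st' rho)) ->
    kappa' * price st' <= kappa * price st ->
  dominated kappa st A.
Proof.
move=> dA AA le Delta D0 Da.
apply: (@le_trans _ _ (kappa' * price st' * expect Delta)).
  apply: le_trans (dA _ D0 Da); apply: (expect_le p01) => rho.
  apply: ler_wpM2l => //; rewrite ler_nat.
  by case: (A _) (AA rho) => // ->.
by apply: ler_wpM2r => //; apply: (expect_ge0 p01).
Qed.

Lemma dominated_or kappa kappa' st A A' :
    dominated kappa st A -> dominated kappa' st A' ->
  dominated (kappa + kappa') st (fun sigma => A sigma || A' sigma).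
Proof.
move=> dA dA' Delta D0 Da; rewrite !mulrDl.
apply: le_trans (lerD (dA _ D0 Da) (dA' _ D0 Da)); rewrite -expectD.
apply: (expect_le p01) => rho; rewrite -mulrDr; apply: ler_wpM2l => //.
by case: (A _); case: (A' _); rewrite /= ?addr0 ?add0r // lerDl.
Qed.

Lemma dominated_false kappa st A :
    0 <= kappa -> (forall rho, A (overlay st rho) = false) ->
  dominated kappa st A.
Proof.
move=> k0 A0 Delta D0 Da; rewrite expect0 => [|rho]; last by rewrite A0 mulr0.
rewrite mulr_ge0 ?(expect_ge0 p01) // mulr_ge0 //.
exact: le_trans ler01 (price_ge1 st).
Qed.

Lemma dominated_trivial st A : dominated 1 st A.
Proof.
move=> Delta D0 Da; rewrite mul1r -[leLHS]mul1r.
apply: ler_pM => //; last 1 first.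
- apply: (expect_le p01) => rho; rewrite -[leRHS]mulr1.
  by apply: ler_wpM2l => //; case: (A _).
- by apply: (expect_ge0 p01) => rho; rewrite mulr_ge0.
- exact: price_ge1.
Qed.

Definition assigned st v : bool :=
  if st v is Some (Some _) then true else false.

Lemma assigned_upd st v w b :
  assigned st w -> assigned (upd st v (Some (Some b))) w.
Proof. by rewrite /assigned ffunE; case: eqP. Qed.

(** Changing the value of an assigned variable keeps the price, so only the union bound over
    reassignments is paid. *)
Lemma dominated_reassigned kappa st P ys :
    (forall st, dominated kappa st P) -> all (assigned st) ys ->
  dominated (kappa * 2 ^+ size ys) st (reassigned ys P).
Proof.
move=> dP; elim: ys st => [|v ys IH] st /=; first by rewrite mulr1.
case/andP=> sv sys.
have prE b : price (upd st v (Some (Some b))) = price st.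
  have := price_upd st v (Some (Some b)).
  move: sv; rewrite /assigned; case: (st v) => [[c|]|] // _.
  by rewrite /star_price /= !mul1r.
have dE b : dominated (kappa * 2 ^+ size ys) st
    (fun sigma => reassigned ys P (assign sigma v b)).
  have sys' : all (assigned (upd st v (Some (Some b)))) ys.
    by apply: sub_all sys => w; apply: assigned_upd.
  apply: dominated_mono (IH _ sys') _ _ => [rho|]; last by rewrite prE.
  by rewrite assign_overlay.
have -> : kappa * 2 ^+ (size ys).+1
    = kappa * 2 ^+ size ys + kappa * 2 ^+ size ys by rewrite exprS; ring.
exact: dominated_or.
Qed.

Lemma falsified_congr sigma sigma' C :
  {in map fst C, sigma =1 sigma'} -> falsified sigma C = falsified sigma' C.
Proof.
by move=> ss; apply: eq_in_has => x xC; rewrite ss //; apply: map_f.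
Qed.

Lemma antitone_upd Delta v x :
  antitone Delta -> antitone (fun rho => Delta (upd rho v x)).
Proof.
move=> Da rho w b; case: (eqVneq w v) => [->|wv]; first by rewrite !upd_upd.
by rewrite !(updC _ _ _ wv).
Qed.

(** A star falsifies no literal, so filling it can only create falsified ones. *)
Lemma antitone_falsified Delta st C :
    (forall rho, 0 <= Delta rho) -> antitone Delta ->
  antitone (fun rho => Delta rho * (falsified (overlay st rho) C)%:R).
Proof.
move=> D0 Da rho v b; apply: ler_pM => //; rewrite ler_nat.
suff : falsified (overlay st (upd rho v None)) C ->
    falsified (overlay st (upd rho v (Some b))) C.
  by case: (falsified _ _) => // ->.
by apply: sub_has => x; rewrite !ffunE; case: (st x.1) => //; case: (x.1 == v).
Qed.

(* Setting the exposed stars to the values that satisfy [C] compares every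
   pattern of stars to the event that [C] is not falsified: this is where
   antitonicity is used. *)
Lemma expect_expose_term kappa A C st Delta :
    0 <= kappa -> uniq (map fst C) ->
    (forall st', (forall v, st v != None -> st' v = st v) ->
       {in map fst C, forall v, st' v != None} -> dominated kappa st' A) ->
    (forall rho, 0 <= Delta rho) -> antitone Delta ->
  expect (fun rho => Delta rho * (~~ falsified (overlay st rho) C)%:R
                     * (A (overlay st rho))%:R)
  <= 2 ^+ size C * kappa * price st
     * expect (fun rho => Delta rho * (~~ falsified (overlay st rho) C)%:R).
Proof.
move=> k0; elim: C st Delta => [|[v b] C IH] st Delta uC HA D0 Da.
  under eq_expect do rewrite mulr1.
  under [X in _ <= _ * X]eq_expect do rewrite mulr1.
  by rewrite mul1r; apply: HA.
have /andP[vC {}uC] : (v \notin map fst C) && uniq (map fst C) := uC.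
have pr0 : 0 <= price st by apply: le_trans ler01 (price_ge1 st).
have G0 : 0 <= 2 ^+ size C * kappa * price st by rewrite !mulr_ge0 ?exprn_ge0.
(* An exposed [v] involves no sampling; its factor 2 is given away. *)
case sv: (st v) => [x|].
  have fE rho : falsified (overlay st rho) ((v, b) :: C) =
      (x == Some (~~ b)) || falsified (overlay st rho) C.
    by rewrite {1}/falsified /= ffunE sv.
  under eq_expect do rewrite fE.
  under [X in _ <= _ * X]eq_expect do rewrite fE.
  case: (x == _) => /=.
    by rewrite !expect0 ?mulr0 // => rho; rewrite ?mulr0 ?mul0r.
  apply: (@le_trans _ _ (2 ^+ size C * kappa * price st *
      expect (fun rho => Delta rho * (~~ falsified (overlay st rho) C)%:R))).
    apply: IH => // st' ext st'C; apply: HA => // w.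
    by rewrite inE => /orP[/eqP ->|/st'C //]; rewrite ext sv.
  apply: ler_wpM2r; first by apply: (expect_ge0 p01) => rho; rewrite mulr_ge0.
  by rewrite exprS -!mulrA ler_peMl ?ler1n // mulrA.
pose st_ x := upd st v (Some x).
have IHx x Delta' := IH (st_ x) Delta' uC.
have HAx x st' : (forall w, st_ x w != None -> st' w = st_ x w) ->
    {in map fst C, forall w, st' w != None} -> dominated kappa st' A.
  move=> ext st'C; apply: HA => w.
    move=> sw; have /negPf wv : w != v.
      by apply: contraNneq sw => ->; rewrite sv.
    by rewrite ext ffunE wv.
  by rewrite inE => /orP[/eqP ->|/st'C //]; rewrite ext upd_same.
have fE rho x : falsified (overlay st (upd rho v x)) ((v, b) :: C) =
    (x == Some (~~ b)) || falsified (overlay (st_ x) rho) C.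
  by rewrite overlay_upd // {1}/falsified /= ffunE upd_same.
have prN : price (st_ None) = (4 * p)^-1 * price st.
  by have := price_upd st v (Some None); rewrite sv /star_price /= mul1r.
have prS c : price (st_ (Some c)) = price st.
  by have := price_upd st v (Some (Some c)); rewrite sv /star_price /= !mul1r.
pose M x := expect (fun rho => Delta (upd rho v x)
                   * (~~ falsified (overlay (st_ x) rho) C)%:R).
have M0 x : 0 <= M x by apply: (expect_ge0 p01) => rho; rewrite mulr_ge0.
(* [C] does not mention [v], so only the weight changes, and antitonicity favours the value
   [Some b]. *)
have leM : M None <= M (Some b).
  apply: (expect_le p01) => rho.
  rewrite (@falsified_congr (overlay (st_ (Some b)) rho)
                            (overlay (st_ None) rho)).
    by apply: ler_wpM2r.
  by move=> w wC; rewrite !ffunE; case: eqP => // wv; rewrite -wv wC in vC.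
have nb : (Some b == Some (~~ b)) = false by case: (b).
have eN : expect (fun rho => Delta (upd rho v None)
      * (~~ falsified (overlay st (upd rho v None)) ((v, b) :: C))%:R
      * (A (overlay st (upd rho v None)))%:R)
    <= 2 ^+ size C * kappa * price st * (4 * p)^-1 * M None.
  have IHn := IHx None _ (HAx None) (fun rho => D0 (upd rho v None))
    (antitone_upd v None Da).
  have -> : 2 ^+ size C * kappa * price st * (4 * p)^-1
      = 2 ^+ size C * kappa * price (st_ None) by rewrite prN; ring.
  apply: le_trans IHn; apply: (expect_le p01) => rho.
  by rewrite fE overlay_upd.
have eS : expect (fun rho => Delta (upd rho v (Some b))
      * (~~ falsified (overlay st (upd rho v (Some b))) ((v, b) :: C))%:R
      * (A (overlay st (upd rho v (Some b))))%:R)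
    <= 2 ^+ size C * kappa * price st * M (Some b).
  rewrite -(prS b).
  have IHs := IHx (Some b) _ (HAx (Some b)) (fun rho => D0 (upd rho v (Some b)))
    (antitone_upd v (Some b) Da).
  apply: le_trans IHs.
  by apply: (expect_le p01) => rho; rewrite fE nb overlay_upd.
rewrite (expect_upd _ _ v b) [X in _ <= _ * X](expect_upd _ _ v b).
rewrite [X in _ + _ * X <= _]expect0 => [|rho]; last first.
  by rewrite fE eqxx mulr0 mul0r.
rewrite [X in _ <= _ * (_ + _ * X)]expect0 => [|rho]; last first.
  by rewrite fE eqxx mulr0.
have -> : expect (fun rho => Delta (upd rho v None)
      * (~~ falsified (overlay st (upd rho v None)) ((v, b) :: C))%:R) = M None.
  by apply: eq_expect => rho; rewrite fE.
have -> : expect (fun rho => Delta (upd rho v (Some b))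
      * (~~ falsified (overlay st (upd rho v (Some b))) ((v, b) :: C))%:R)
    = M (Some b).
  by apply: eq_expect => rho; rewrite fE nb.
rewrite [size _]/= exprS.
move: (M0 None) (M0 (Some b)) leM eN eS G0.
rewrite -[2 * _ * _]mulrA -[2 * _ * _]mulrA.
set G := 2 ^+ size C * kappa * price st.
move: (M None) (M (Some b)) (expect _) (expect _) G.
move=> m1 m2 e2 e1 G m1_0 m2_0 m12 e1G e2G G0.
(* The price [(4 * p)^-1] of the star meets its probability [p], leaving 1/4. *)
have pe1 : p * e1 <= G * m2 / 4.
  apply: (@le_trans _ _ (p * (G * (4 * p)^-1 * m1))).
    by apply: ler_wpM2l => //; apply: ltW.
  have -> : p * (G * (4 * p)^-1 * m1) = G * m1 / 4.
    by field; rewrite gt_eqF.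
  have := ler_wpM2l G0 m12; lra.
have Gm2 : 0 <= G * m2 by apply: mulr_ge0.
have Gm1 : 0 <= p * (G * m1) by rewrite !mulr_ge0 // ltW.
have qe2 : (1 - p) / 2 * e2 <= (1 - p) / 2 * (G * m2).
  by apply: ler_wpM2l => //; plra.
(* Since [p <= 1 / 2], the share of the star is at most that of the satisfying value, whence a
   factor 2 per literal. *)
have q4 : G * m2 / 4 <= (1 - p) / 2 * (G * m2).
  by rewrite mulrC; apply: ler_wpM2r => //; plra.
by rewrite !mulr0 !addr0; lra.
Qed.

(** * Walking through one DNF within a block *)

Section Block.

Variables (k : nat) (kappa : R) (P : pred (restriction n)).
Hypotheses (kappa_ge0 : 0 <= kappa) (dP : forall st, dominated kappa st P).

Let B : R := 2 ^+ k * 2 ^+ k.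

(** [m] queries of the block are done and [d] remain: all [m + d] variables get reassigned, but only
    the remaining ones still pay [4 * p * B]. *)
Definition walk_bound (d m : nat) : R :=
  kappa * 2 ^+ (m + d) * (4 * p * B) ^+ d.

Let B_ge1 : 1 <= B.
Proof.
by rewrite /B -exprD exprn_ege1 // ler1n.
Qed.

Let B_gt0 : 0 < B.
Proof. exact: lt_le_trans ltr01 B_ge1. Qed.

Lemma walk_bound_ge0 d m : 0 <= walk_bound d m.
Proof.
have l0 : 0 <= 4 * p * B.
  by rewrite mulr_ge0 ?(ltW B_gt0) //; plra.
by rewrite /walk_bound mulr_ge0 ?exprn_ge0 // mulr_ge0 ?exprn_ge0.
Qed.

(** All variables of [D] are prepaid stars, so the first query costs [4 * p] without the factor [B],
    which explains [B^-1]; for [d = 0] nothing is queried and nothing is saved. *)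
Lemma dominated_term_walk F (D : term n) st d ys :
    (forall st d ys, all (assigned st) ys ->
       dominated (walk_bound d (size ys)) st (walk d (walk_tree F) ys P)) ->
    uniq (map fst D) -> {in map fst D, forall v, st v = Some None} ->
    all (assigned st) ys ->
  dominated
    (2 ^+ size D * walk_bound d (size ys) * (if d == 0%N then 1 else B^-1))
    st (walk d (term_walk_tree F D) ys P).
Proof.
move=> HF; elim: D st d ys => [|[v b] D IH] st [|d] ys uD sD sys.
1,3: apply: dominated_mono (dominated_reassigned dP sys) _ _;
   first by move=> rho; rewrite walk0.
- by rewrite /walk_bound addn0 !mulr1 mul1r.
- apply: ler_wpM2r; first exact: le_trans ler01 (price_ge1 st).
  rewrite /walk_bound addn0 !mulr1 ler_peMl //.
    by rewrite mulr_ge0 // exprn_ge0.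
  by apply: exprn_ege1; rewrite ler1n.
- apply: dominated_false => //.
  by rewrite mul1r mulr_ge0 ?walk_bound_ge0 // invr_ge0 ltW.
case/andP: uD => /= vD uD.
have sv : st v = Some None by apply: sD; rewrite mem_head.
have sys' c : all (assigned (upd st v (Some (Some c)))) (rcons ys v).
  rewrite all_rcons {1}/assigned upd_same /=.
  by apply: sub_all sys => w; apply: assigned_upd.
pose W := walk_bound d.+1 (size ys) / B.
have step (T : restriction n -> dtree n bool) c (e : R) :
    0 <= e ->
    dominated (e * walk_bound d (size ys).+1) (upd st v (Some (Some c)))
      (walk d T (rcons ys v) P) ->
    dominated (e * W) st
      (fun sigma => walk d T (rcons ys v) P (assign sigma v c)).
  move=> e0 dT; apply: dominated_mono dT _ _.
    by move=> rho; rewrite assign_overlay.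
  rewrite price_assign_star // le_eqVlt; apply/orP; left; apply/eqP.
  have B0 : B != 0 by rewrite gt_eqF.
  rewrite /W /walk_bound addSnnS exprS; field.
  exact: B0.
(* The exit branch contributes [W] and the other one [2 ^+ size D * W], together at most twice the
   latter. *)
have d1 := step (walk_tree F) (~~ b) 1 ler01.
rewrite mul1r -(size_rcons ys v) in d1.
have {d1} d1 := d1 (HF _ _ _ (sys' (~~ b))).
have d2 : dominated (2 ^+ size D * W) st
    (fun sigma =>
       walk d (term_walk_tree F D) (rcons ys v) P (assign sigma v b)).
  apply: step; first by rewrite exprn_ge0.
  have sD' : {in map fst D, forall w, upd st v (Some (Some b)) w = Some None}.
    move=> w wD; rewrite ffunE; case: eqP => [wv|_].
      by rewrite -wv wD in vD.
    by apply: sD; rewrite inE wD orbT.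
  apply: dominated_mono (IH _ d _ uD sD' (sys' b)) _ _ => //.
  apply: ler_wpM2r; first exact: le_trans ler01 (price_ge1 _).
  rewrite size_rcons -[leRHS]mulr1; apply: ler_wpM2l.
    by rewrite mulr_ge0 ?exprn_ge0 ?walk_bound_ge0.
  by case: eqP => // _; rewrite invf_le1.
apply: dominated_mono (dominated_or d1 d2) _ _.
  by move=> rho; rewrite walk_term_cons.
apply: ler_wpM2r; first exact: le_trans ler01 (price_ge1 _).
have W0 : 0 <= W by rewrite mulr_ge0 ?walk_bound_ge0 // invr_ge0 ltW.
rewrite -mulrA -/W -mulrDl exprS; apply: ler_wpM2r => //.
have h : (1 : R) <= 2 ^+ size D by apply: exprn_ege1; rewrite ler1n.
by lra.
Qed.

(** [Delta] is split by whether the first term is falsified: one part passes to the later terms as a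
    new weight, the other exposes the term. The two weights add up to [Delta], so the bound does not
    grow with the number of terms. *)
Lemma dominated_walk F st d ys :
    is_kdnf k F -> all (assigned st) ys ->
  dominated (walk_bound d (size ys)) st (walk d (walk_tree F) ys P).
Proof.
move=> + sys; case: d => [|d] kF.
  apply: dominated_mono (dominated_reassigned dP sys) _ _ => [rho|].
    by rewrite walk0.
  by rewrite /walk_bound addn0 !mulr1.
elim: F st d ys kF sys => [|C F IH] st d ys /=.
  by move=> _ _; apply: dominated_false => //; apply: walk_bound_ge0.
case/andP=> /andP[uC sC] kF sys Delta D0 Da.
have HF st' d' ys' : all (assigned st') ys' ->
    dominated (walk_bound d' (size ys')) st' (walk d' (walk_tree F) ys' P).
  move=> sys'; case: d' => [|d']; last exact: IH.
  apply: dominated_mono (dominated_reassigned dP sys') _ _ => [rho|].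
    by rewrite walk0.
  by rewrite /walk_bound addn0 !mulr1.
set W := walk_bound d.+1 (size ys).
have W0 : 0 <= W by apply: walk_bound_ge0.
pose A sigma := walk d.+1
  (fun sigma => term_walk_tree F (unfixed sigma C) sigma) ys P sigma.
have dA st' : (forall v, st v != None -> st' v = st v) ->
    {in map fst C, forall v, st' v != None} ->
    dominated (2 ^+ k * (W / B)) st' A.
  (* Every variable of [C] is exposed in [st'], so the residual term is [D] whatever [rho] is. *)
  move=> ext st'C; pose D := [seq x <- C | st' x.1 == Some None].
  have sD : {in map fst D, forall v, st' v = Some None}.
    by move=> v /mapP[x]; rewrite mem_filter => /andP[/eqP sx _] ->.
  have uD : uniq (map fst D).
    by apply: subseq_uniq uC; apply: map_subseq; apply: filter_subseq.
  have sys' : all (assigned st') ys.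
    apply: sub_all sys => v; rewrite /assigned => sv; rewrite ext //.
    by case: (st v) sv.
  apply: dominated_mono (dominated_term_walk d.+1 HF uD sD sys') _ _.
    move=> rho; rewrite /A /walk.
    suff -> : unfixed (overlay st' rho) C = D by [].
    apply: eq_in_filter => x xC; rewrite ffunE.
    by have := st'C x.1 (map_f fst xC); case: (st' x.1).
  apply: ler_wpM2r; first exact: le_trans ler01 (price_ge1 _).
  rewrite -mulrA; apply: ler_wpM2r; first by rewrite mulr_ge0 // invr_ge0 ltW.
  apply: ler_weXn2l; first by rewrite ler1n.
  by rewrite size_filter; apply: leq_trans (count_size _ _) sC.
have k0 : 0 <= 2 ^+ k * (W / B).
  by rewrite mulr_ge0 ?exprn_ge0 // mulr_ge0 // invr_ge0 ltW.
have e1 := HF st d.+1 ys sys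
  (fun rho => Delta rho * (falsified (overlay st rho) C)%:R)
  (fun rho => mulr_ge0 (D0 rho) (ler0n _ _)) (antitone_falsified st C D0 Da).
have e2 := expect_expose_term k0 uC dA D0 Da.
have split rho : Delta rho = Delta rho * (falsified (overlay st rho) C)%:R
    + Delta rho * (~~ falsified (overlay st rho) C)%:R.
  by case: (falsified _ _); rewrite /= mulr1 mulr0 ?addr0 ?add0r.
rewrite [X in _ <= _ * X](eq_expect _ split) expectD mulrDr.
apply: (@le_trans _ _ (_ + _)); last first.
  apply: lerD; first exact: e1.
  apply: le_trans e2 _; apply: ler_wpM2r.
    by apply: (expect_ge0 p01) => rho; rewrite mulr_ge0.
  apply: ler_wpM2r; first exact: le_trans ler01 (price_ge1 _).
  (* The star patterns and the ways through the term together cancel [B] and give back exactly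
     [W]. *)
  apply: (@le_trans _ _ (2 ^+ k * (2 ^+ k * (W / B)))).
    apply: ler_wpM2r => //; apply: ler_weXn2l => //; by rewrite ler1n.
  by rewrite mulrA -/B mulrC divfK // gt_eqF.
rewrite -expectD; apply: (expect_le p01) => rho.
rewrite {1}split /A /walk /= mulrDl; apply: lerD.
  by case: ifP => // _; rewrite mulr0 !mul0r.
by case: ifP => // _; rewrite mulr0 !mul0r.
Qed.

End Block.

(** Outer induction on the number [r] of blocks, inner one on the collection, adding one block event
    per formula. Sizes below [s] are allowed because later blocks start from a suffix. For [r > 0]
    the last hypothesis says that [r - 1] full blocks stay below depth [t]. *)
Lemma dominated_deep k l s r t (Fs : seq (dnf n)) st :
    all (is_kdnf k) Fs -> (size Fs <= s)%N -> (r * l.+1 < t + l.+1)%N ->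
  dominated (s%:R ^+ r * (8 * p * (2 ^+ k * 2 ^+ k)) ^+ (r * l.+1)) st
    (deep l t Fs).
Proof.
elim: r t Fs st => [|r IH] t Fs st kFs sFs rt.
  by rewrite mul1r; apply: dominated_trivial.
set c := 8 * p * (2 ^+ k * 2 ^+ k) in IH *.
have c0 : 0 <= c by rewrite /c mulr_ge0 ?mulr_ge0 ?exprn_ge0 // ltW.
pose kap : R := s%:R ^+ r * c ^+ (r * l.+1).
have kap0 : 0 <= kap by rewrite mulr_ge0 ?exprn_ge0.
suff dFs : dominated ((size Fs)%:R * (kap * c ^+ l.+1)) st (deep l t Fs).
  apply: dominated_mono dFs _ _ => //.
  apply: ler_wpM2r; first exact: le_trans ler01 (price_ge1 _).
  have -> : s%:R ^+ r.+1 * c ^+ (r.+1 * l.+1) = s%:R * (kap * c ^+ l.+1).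
    by rewrite exprS mulSn exprD /kap; ring.
  by apply: ler_wpM2r; rewrite ?ler_nat // mulr_ge0 ?exprn_ge0.
elim: Fs kFs sFs => [|F Fs IHF] /= kFs sFs.
  apply: dominated_false => [|rho]; first by rewrite mul0r.
  by rewrite /deep CCDT_nil leqn0; apply: gtn_eqF; lia.
case/andP: (kFs) => kF kFs'.
have db : dominated (kap * c ^+ l.+1) st (block l t F Fs).
  (* If [t <= l] the difference truncates to 0, but then [r = 0] and the hypothesis on [r] still
     holds. *)
  have dP st' : dominated kap st' (deep l (t - l.+1) (F :: Fs)).
    by apply: IH => //; lia.
  have dW := dominated_walk (st := st) (ys := [::]) kap0 dP l.+1 kF isT.
  apply: dominated_mono dW _ _ => //.
  apply: ler_wpM2r; first exact: le_trans ler01 (price_ge1 _).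
  rewrite /walk_bound add0n -mulrA -exprMn /c.
  have -> // : 2 * (4 * p * (2 ^+ k * 2 ^+ k)) = 8 * p * (2 ^+ k * 2 ^+ k) :> R.
  by ring.
have dFs := IHF kFs' (ltnW sFs).
apply: dominated_mono (dominated_or dFs db) _ _; first by move=> rho /deep_cons.
apply: ler_wpM2r; first exact: le_trans ler01 (price_ge1 _).
by rewrite -natr1 mulrDl mul1r.
Qed.

(** The state with nothing exposed has price 1; the weight is constantly 1. *)
Lemma Pr_deep_le k l s t (Fs : seq (dnf n)) r :
    all (is_kdnf k) Fs -> (size Fs <= s)%N -> (r * l.+1 < t + l.+1)%N ->
  Pr_Rp p (deep l t Fs)
    <= s%:R ^+ r * (8 * p * (2 ^+ k * 2 ^+ k)) ^+ (r * l.+1).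
Proof.
move=> kFs sFs rt.
have free0 rho : overlay [ffun=> None] rho = rho.
  by apply/ffunP => v; rewrite !ffunE.
have := dominated_deep [ffun=> None] kFs sFs rt
  (fun=> ler01) (fun _ _ _ => lexx 1).
rewrite expect1 mulr1 /price big1 ?mulr1 => [|v _]; last by rewrite ffunE.
apply: le_trans; rewrite /Pr_Rp /expect big_mkcond; apply: ler_sum => rho _.
by rewrite free0 mul1r; case: ifP; rewrite ?mulr1 ?mulr0.
Qed.

End Domination.

(** * Degenerate parameters and the final estimate *)

Lemma Pr_Rp_le1 (R : realFieldType) n (p : R) (E : pred (restriction n)) :
  0 <= p <= 1 -> Pr_Rp p E <= 1.
Proof.
move=> p01; rewrite -[leRHS](expect1 n p) /Pr_Rp /expect big_mkcond.
apply: ler_sum => rho _; rewrite mulr1; case: ifP => // _.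
exact: Rp_weight_ge0.
Qed.

Lemma CCDT_vars_nonempty n l (Fs : seq (dnf n)) :
  (0 < depth (CCDT l Fs))%N -> exists v, v \in dnfs_vars Fs.
Proof.
elim: Fs => [|F Fs IH]; first by rewrite CCDT_nil.
have [le|lt] := leqP (depth (CDT F)) l.
  rewrite CCDT_shallow // => /IH[v vFs]; exists v.
  by rewrite /dnfs_vars /= mem_cat vFs orbT.
move=> _; have := @CDT_vars _ F; case: (CDT F) lt => [//|v T0 T1] _ vF.
by exists v; rewrite /dnfs_vars /= mem_cat vF // mem_head.
Qed.

Lemma kdnf0_vars n (Fs : seq (dnf n)) v :
  all (is_kdnf 0) Fs -> v \notin dnfs_vars Fs.
Proof.
move=> kFs; apply/negP => /flattenP[_ /mapP[F FFs ->]] /mapP[x].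
case/flattenP=> C CF xC _; have /allP/(_ C CF)/andP[_] := allP kFs F FFs.
by case: C xC {CF}.
Qed.

Theorem theorem6p9 :
  exists c : nat,
    forall (R : realFieldType) (n k s : nat) (Fs : s.-tuple (dnf n)) (p : R),
      all (is_kdnf k) Fs ->
      0 <= p <= 1 ->
      forall l t : nat, (0 < l)%N ->
        Pr_Rp p (fun rho : restriction n =>
                   (t <= depth (CCDT l (restrict_dnfs rho Fs)))%N)
        <= s%:R ^+ ceil_div t l * (p * 2 ^+ (c * k)%N) ^+ t.
Proof.
(* For [k > 0], [8 * 4 ^ k = 2 ^ (3 + 2 * k)] is at most [2 ^ (5 * k)]. *)
exists 5%N => R n k s Fs p kFs p01 l t l0.
case/andP: (p01) => p0 p1.
have rhs0 : 0 <= s%:R ^+ ceil_div t l * (p * 2 ^+ (5 * k)%N) ^+ t.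
  by rewrite mulr_ge0 ?exprn_ge0 // mulr_ge0 ?exprn_ge0.
have [->|t0] := posnP t.
  by rewrite /ceil_div add0n divn_small ?mulr1 ?Pr_Rp_le1 // prednK.
(* As [t > 0], the event requires a variable left alive. For [s = 0] or [k = 0] there is none, and
   for [p = 0] a star has weight 0. *)
have null :
    (forall rho v, v \in dnfs_vars (restrict_dnfs rho Fs) ->
       Rp_weight p rho = 0) ->
    Pr_Rp p (fun rho => (t <= depth (CCDT l (restrict_dnfs rho Fs)))%N)
    <= s%:R ^+ ceil_div t l * (p * 2 ^+ (5 * k)%N) ^+ t.
  move=> w0; rewrite /Pr_Rp big1 // => rho /(leq_trans t0) /CCDT_vars_nonempty[v].
  exact: w0.
have [s0|s0] := posnP s.
  apply: null => rho v; have := size_tuple Fs; rewrite {2}s0.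
  by move=> /size0nil ->.
have [k0|k0] := posnP k.
  apply: null => rho v /restrict_dnfs_vars /andP[+ _].
  by rewrite k0 in kFs; rewrite (negPf (kdnf0_vars v kFs)).
have [p_0|pn0] := eqVneq p 0.
  apply: null => rho v /restrict_dnfs_vars /andP[_ rv].
  by rewrite /Rp_weight (bigD1 v) //= rv p_0 mul0r.
have sr_ge1 m : 1 <= s%:R ^+ m :> R by apply: exprn_ege1; rewrite ler1n.
(* If the base is at least 1, so is the right-hand side. Otherwise [4 * p <= 1] follows, and raising
   the exponent from [t] to [r * l.+1] only lowers the power. *)
have [big|small] := lerP 1 (p * 2 ^+ (5 * k)).
  apply: le_trans (Pr_Rp_le1 _ p01) _.
  by rewrite -[leLHS]mulr1; apply: ler_pM => //; apply: exprn_ege1.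
have p_gt0 : 0 < p by rewrite lt_neqAle eq_sym pn0.
have h5 : 2 ^+ (3 + (k + k)) <= 2 ^+ (5 * k) :> R.
  by apply: ler_weXn2l; [rewrite ler1n | lia].
have p_le : 4 * p <= 1.
  apply: le_trans (ltW small); rewrite mulrC; apply: ler_wpM2l => //.
  apply: (@le_trans _ _ (2 ^+ 2)); first by rewrite -natrX.
  by apply: ler_weXn2l; [rewrite ler1n | lia].
(* Blocks have [l + 1] queries, so [r] of them are counted; [r] is at most the claimed exponent of
   [s]. *)
pose r := ceil_div t l.+1.
have rE : (r * l.+1 <= t + l)%N by apply: leq_trunc_div.
have tr : (t <= r * l.+1)%N.
  have := ltn_ceil (t + l) (ltn0Sn l); rewrite -/(ceil_div t l.+1) -/r.
  by rewrite mulSn; lia.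
have rl : (r <= ceil_div t l)%N.
  have := ltn_ceil (t + l.-1) l0; rewrite -/(ceil_div t l).
  move: (ceil_div t l) => m hm.
  have tm : (t <= m * l)%N by move: hm; rewrite mulSn; lia.
  rewrite -ltnS /r /ceil_div /= ltn_divLR //; nia.
have rt : (r * l.+1 < t + l.+1)%N by lia.
have sFs : (size Fs <= s)%N by rewrite size_tuple.
apply: le_trans (Pr_deep_le p_gt0 p_le kFs sFs rt) _.
have c5 : 8 * p * (2 ^+ k * 2 ^+ k) <= p * 2 ^+ (5 * k).
  rewrite [8 * p]mulrC -mulrA; apply: ler_wpM2l => //.
  apply: le_trans h5; rewrite !exprD.
  by apply: ler_wpM2r; rewrite ?mulr_ge0 ?exprn_ge0 // -natrX.
have c0 : 0 <= 8 * p * (2 ^+ k * 2 ^+ k) by rewrite !mulr_ge0 ?exprn_ge0.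
apply: ler_pM; rewrite ?exprn_ge0 //.
  by apply: ler_weXn2l; rewrite ?ler1n.
apply: le_trans (_ : (p * 2 ^+ (5 * k)) ^+ (r * l.+1) <= _).
  by apply: lerXn2r; rewrite ?nnegrE // (le_trans c0 c5).
by apply: ler_wiXn2l => //; [apply: le_trans c5 | apply: ltW].
Qed.
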